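(* Let $E$ be a separable Banach space with norm $|\cdot|$ and let $(\mu_\alpha)_{\alpha\in\mathcal A}$ be a family of centered Gaussian probabilities on $E$ for which there exist $s>0$ and a constant $\beta<\frac12$ such that $\mu_\alpha(|x|>s)\le\beta$ for every $\alpha\in\mathcal A$. Then $$\sup_{\alpha\in\mathcal A}\int_E e^{t|x|}\,d\mu_\alpha(x)<+\infty\qquad\text{for every }t>0.$$ In particular, this conclusion holds if the family $(\mu_\alpha)_{\alpha\in\mathcal A}$ of centered Gaussian probabilities is tight.
   Context: A centered Gaussian probability on $E$ is a Borel probability $\mu$ such that, under $\mu$, $x\mapsto\langle\theta,x\rangle$ is a (possibly degenerate) centered real Gaussian random variable for every $\theta$ in the topological dual $E'$. A family $(\mu_\alpha)_{\alpha\in\mathcal A}$ is tight if for every $\delta>0$ there is a compact set $K_\delta\subset E$ with $\mu_\alpha(E\setminus K_\delta)<\delta$ for every $\alpha\in\mathcal A$. *)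

(* Defs.v *)
From HB Require Import structures.
From mathcomp Require Import all_boot all_order all_algebra.
From mathcomp Require Import all_classical all_reals all_analysis.

Set Implicit Arguments.
Unset Strict Implicit.
Unset Printing Implicit Defensive.

Import Order.TTheory GRing.Theory Num.Theory.
Import numFieldNormedType.Exports.

Local Open Scope classical_set_scope.
Local Open Scope ring_scope.

Definition separable (T : topologicalType) : Prop :=
  exists D : set T, countable D /\ dense D.

Notation borel E := (g_sigma_algebraType (@open E)).

(* The degenerate law is listed separately because the library's
   [normal_prob m 0] is the uniform law on [0, 1], not the Dirac mass at m. *)
Definition centered_gaussian_law (R : realType)
    (nu : set (measurableTypeR R) -> \bar R) : Prop :=
  (exists2 sigma : R, 0 < sigma &
     forall B : set (measurableTypeR R),
       measurable B -> nu B = normal_prob 0 sigma B) \/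
  (forall B : set (measurableTypeR R), measurable B -> nu B = \d_(0 : R) B).

Definition centered_gaussian (R : realType) (E : completeNormedModType R)
    (mu : probability (borel E) R) : Prop :=
  forall theta : {linear E -> R^o}, continuous theta ->
    centered_gaussian_law
      (pushforward mu (theta : borel E -> measurableTypeR R)).

Definition tight (R : realType) (E : completeNormedModType R) (A : Type)
    (mu : A -> probability (borel E) R) : Prop :=
  forall delta : R, 0 < delta ->
    exists2 K : set E, compact K & forall a, (mu a (~` K) < delta%:E)%E.

(* Main.v *)
Require Import Defs.
From HB Require Import structures.
From mathcomp Require Import all_boot all_order all_algebra.
From mathcomp Require Import all_classical all_reals all_analysis.
From mathcomp Require Import measurable_realfun ring lra.

Import Order.TTheory GRing.Theory Num.Theory.
Import numFieldNormedType.Exports.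

Local Open Scope classical_set_scope.
Local Open Scope ring_scope.

(** The law of a centered Gaussian measure mu is determined by its
    one-dimensional marginals, hence mu x mu is invariant under the rotation by
    45 degrees (x, y) |-> ((x - y) / sqrt 2, (x + y) / sqrt 2). Following
    Fernique, on the rotated event {|x - y| / sqrt 2 <= s} and
    {|x + y| / sqrt 2 > sqrt 2 u + s} both |x| and |y| exceed u, so that
      mu(|x| <= s) mu(|x| > sqrt 2 u + s) <= mu(|x| > u)^2.
    Iterating from u = s with mu(|x| > s) <= beta < 1/2 gives
    mu(|x| > s_n) <= rho^(2^n) with rho = beta / (1 - beta) < 1, along radii s_n
    that grow like (sqrt 2)^n. The tail is therefore Gaussian, with constants
    that depend on s and beta only, and the exponential moments are bounded
    uniformly over all centered Gaussian mu with mu(|x| > s) <= beta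
    ([gaussian_exp_moment_bounded]). A tight family is of this kind, because a
    compact set is bounded.

    The rotation invariance ([rotation45_invariant]) rests on four facts.
    - The norm of a separable space is the supremum of countably many functionals
      ([norming_sequence], from the Hahn-Banach theorem), so the Borel sets are
      generated by the half-spaces ([measurable_fun_borel]).
    - Two probabilities under which all l in a vector space L of functions have
      the same characteristic function agree on the sigma-algebra generated by
      L ([charfun_measure_unique]). The trigonometric polynomials in L form an
      algebra of bounded functions on which the integrals agree. Explicit
      polynomials turn the elements of such an algebra into indicators
      ([cvg_threshold], [algebra_measure_unique]), and the pi-lambda theorem
      applies.
    - The characteristic function of N(0, s^2) is exp(- u^2 s^2 / 2): by Stein's
      identity ([stein]) it solves K' = - u s^2 K ([normal_charfun]). The same
      identity gives the second moment s^2 ([normal_moment2]), so the exponent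
      can be written with the quadratic form l |-> E l(x)^2.
    - This quadratic form satisfies the parallelogram law, so the
      characteristic function of mu x mu is unchanged by the rotation
      ([product_charfun], [variance_parallelogram]). *)

(** * The Hahn-Banach theorem and norming functionals *)

Section hahn_banach.
Context {R : realType} {E : normedModType R}.
Implicit Types (G : set (E * R)).

(** Graph of a linear functional, bounded above by the norm, on a subspace
    that contains d. The last clause makes the empty graph admissible: the
    class then contains the union of the empty chain, as the subset form of
    Zorn's lemma demands. *)
Definition dominated_graph (d : E) G :=
  [/\ forall a p q, G p -> G q -> G (a *: p.1 + q.1, a * p.2 + q.2),
      forall p, G p -> p.2 <= `|p.1| &
      forall p, G p -> G (d, `|d|)].

Lemma dominated_graph_bigcup d (F : set (set (E * R))) :
  F `<=` dominated_graph d -> total_on F subset ->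
  dominated_graph d (\bigcup_(G in F) G).
Proof.
move=> FP Ftot; split.
- move=> a p q [G FG Gp] [H FH Hq].
  have [GH|HG] := Ftot _ _ FG FH.
  + by exists H => //; have [cl _ _] := FP _ FH; apply: cl => //; exact: GH.
  + by exists G => //; have [cl _ _] := FP _ FG; apply: cl => //; exact: HG.
- by move=> p [G FG Gp]; have [_ dom _] := FP _ FG; exact: dom.
- by move=> p [G FG Gp]; have [_ _ Gd] := FP _ FG; exists G => //; exact: Gd Gp.
Qed.

Lemma dominated_graph_fun d G x r r' :
  dominated_graph d G -> G (x, r) -> G (x, r') -> r = r'.
Proof.
move=> [cl dom _].
suff le s s' : G (x, s) -> G (x, s') -> s' <= s.
  by move=> Gr Gr'; apply/eqP; rewrite eq_le !le.
move=> Gs Gs'; have := dom _ (cl (-1) _ _ Gs Gs').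
by rewrite /= scaleN1r addNr normr0 mulN1r addrC subr_le0.
Qed.

(** The value c that an extension may take at z. It separates the numbers
    r - |x - z| from the numbers |x + z| - r, and it exists because
    r + s <= |x + y| <= |x - z| + |y + z|. *)
Lemma dominated_graph_extend d G z : dominated_graph d G -> G (d, `|d|) ->
  exists c : R, forall x r, G (x, r) ->
    r - `|x - z| <= c /\ c <= `|x + z| - r.
Proof.
move=> [cl dom _] Gd.
pose S := [set u : R | exists x r, G (x, r) /\ u = r - `|x - z|].
have Sub y s : G (y, s) -> ubound S (`|y + z| - s).
  move=> Gy _ [x [r [Gx ->]]]; have := dom _ (cl 1 _ _ Gx Gy) => /=.
  rewrite scale1r mul1r lerBlDr addrAC lerBrDr => /le_trans; apply.
  have -> : x + y = (y + z) + (x - z) by rewrite addrACA subrr addr0 addrC.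
  exact: ler_normD.
have S0 : S !=set0 by exists (`|d| - `|d - z|), d, `|d|.
exists (sup S) => x r Gx; split.
  apply: ub_le_sup; last by exists x, r.
  by exists (`|d + z| - `|d|); exact: Sub.
exact: ge_sup (Sub _ _ Gx).
Qed.

(** A maximal dominated graph is defined everywhere: the extension by any
    point outside its domain would be larger. *)
Lemma hahn_banach_norm (d : E) : exists f : E -> R,
  [/\ linear (f : E -> R^o), forall x, `|f x| <= `|x| & f d = `|d|].
Proof.
have [G [PG Gmax]] := Zorn_bigcup (@dominated_graph_bigcup d).
have [cl dom Gd'] := PG.
have Gd : G (d, `|d|).
  apply: contrapT => nGd.
  have G0 p : ~ G p by move=> /Gd'.
  (* the graph over the line spanned by d *)
  pose H := [set p : E * R | exists t, p = (t *: d, t * `|d|)].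
  apply: (Gmax H).
    by split => [p /G0//|]; move=> /(_ (d, `|d|)) HG; apply/nGd/HG;
      exists 1; rewrite scale1r mul1r.
  split.
  - move=> a _ _ [t ->] [u ->]; exists (a * t + u) => /=.
    by rewrite scalerDl mulrDl scalerA mulrA.
  - by move=> _ [t ->] /=; rewrite normrZ ler_wpM2r// ler_norm.
  - by move=> _ _; exists 1; rewrite scale1r mul1r.
have Gtot z : exists r, G (z, r).
  apply: contrapT => nGz.
  have [c cP] := dominated_graph_extend d G z PG Gd.
  pose H := [set p : E * R | exists x r t,
    G (x, r) /\ p = (x + t *: z, r + t * c)].
  have GH : G `<=` H.
    by move=> [x r] Gx; exists x, r, 0; rewrite scale0r mul0r !addr0.
  have G00 : G (0, 0).
    by have := cl (-1) _ _ Gd Gd; rewrite /= scaleN1r mulN1r !addNr.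
  apply: (Gmax H).
    split => //; move=> HG; apply: nGz; exists c; apply: HG.
    by exists 0, 0, 1; rewrite scale1r mul1r !add0r.
  split.
  - move=> a _ _ [x [r [t [Gx ->]]]] [y [s [u [Gy ->]]]] /=.
    exists (a *: x + y), (a * r + s), (a * t + u); split.
      exact: (cl a _ _ Gx Gy).
    congr pair; last by ring.
    by rewrite scalerDr scalerDl scalerA addrACA.
  - move=> _ [x [r [t [Gx ->]]]] /=.
    have GZ a : G (a *: x, a * r).
      by have := cl a _ _ Gx G00; rewrite /= !addr0.
    have [t0|t0|->] := ltgtP t 0.
    + have [+ _] := cP _ _ (GZ (- t)^-1).
      have Nt0 : 0 < - t by rewrite oppr_gt0.
      rewrite lerBlDr -(ler_pM2l Nt0) mulrA mulfV ?gt_eqF// mul1r.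
      rewrite mulrDr -{2}(gtr0_norm Nt0) -normrZ scalerBr scalerA mulfV ?gt_eqF//.
      by rewrite scale1r scaleNr opprK mulNr -lerBlDl opprK.
    + have [_] := cP _ _ (GZ t^-1).
      rewrite -(ler_pM2l t0) mulrBr mulrA mulfV ?gt_eqF// mul1r.
      rewrite -{2}(gtr0_norm t0) -normrZ scalerDr scalerA mulfV ?gt_eqF//.
      by rewrite scale1r lerBrDr addrC.
    + by rewrite scale0r mul0r !addr0; exact: dom Gx.
  - by move=> _ _; exact: GH.
have [f fP] := choice Gtot.
have flin : linear (f : E -> R^o).
  move=> a x y; apply: (dominated_graph_fun _ _ _ _ _ PG (fP _)).
  exact: (cl a _ _ (fP x) (fP y)).
have fle x : f x <= `|x| := dom _ (fP x).
exists f; split=> //.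
- move=> x; rewrite ler_norml fle andbT lerNl -normrN.
  suff -> : - f x = f (- x) by exact: fle.
  have f0 : f 0 = 0.
    by have := flin (-1) 0 0; rewrite scaler0 addr0 scaleN1r addNr.
  by have := flin (-1) x 0; rewrite !addr0 f0 addr0 !scaleN1r.
- exact: (dominated_graph_fun _ _ _ _ _ PG (fP d) Gd).
Qed.

End hahn_banach.

Lemma linear_formB {R : realType} {E : lmodType R} (f : E -> R) :
  linear (f : E -> R^o) -> {morph f : x y / x - y}.
Proof. by move=> fl x y; rewrite addrC -scaleN1r fl scaleN1r addrC. Qed.

Lemma separable_dense_sequence {R : realType} (E : normedModType R) :
  separable E -> exists g : nat -> E, dense (range g).
Proof.
move=> [D [cD dD]].
have [d0 [_ Dd0]] : (setT `&` D) !=set0.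
  by apply: dD; [exists 0|exact: openT].
have /pfcard_geP[D0|[h]] := cD; first by move: Dd0; rewrite D0.
exists h => O O0 Oo; have [x [Ox Dx]] := dD _ O0 Oo.
by exists x; split => //; exact: surj Dx.
Qed.

(** It suffices to norm a dense sequence g: if l is norm-decreasing with
    l (g n) = |g n|, then |x| <= l x + 2 |x - g n|. *)
Lemma norming_sequence {R : realType} (E : normedModType R) :
  separable E -> exists f : nat -> E -> R,
  [/\ forall n, linear (f n : E -> R^o), forall n, continuous (f n) &
      forall x r, `|x| <= r <-> forall n, f n x <= r].
Proof.
move=> /separable_dense_sequence[g dg].
have [f fP] := choice (fun n => hahn_banach_norm (g n)).
exists f; split; first by move=> n; have [] := fP n.
- move=> n; have [fl fn _] := fP n.
  move=> x; apply/cvgrPdist_lt => e e0; near=> y.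
  rewrite -linear_formB//.
  apply: le_lt_trans (fn _) _; near: y.
  by have /cvgrPdist_lt/(_ _ e0) : y @[y --> x] --> x by exact: cvg_id.
- move=> x r; split.
    move=> xr n; have [_ fn _] := fP n.
    exact: le_trans (ler_norm _) (le_trans (fn _) xr).
  move=> fr; apply/ler_addgt0Pr => e e0.
  have e20 : 0 < e / 2 by rewrite divr_gt0.
  have [_ [] /[swap] [[n _ <-]]] : (ball x (e / 2) `&` range g) !=set0.
    by apply: dg; [exists x; exact: ballxx|exact: ball_open].
  rewrite -ball_normE /= => xd; have [fl fn fd] := fP n.
  have -> : x = g n + (x - g n) by rewrite addrC subrK.
  apply: le_trans (ler_normD _ _) _; rewrite -fd.
  have := fn (g n - x); have := ler_norm (f n (g n - x)); have := fr n.
  rewrite linear_formB// (distrC (g n)); lra.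
Unshelve. all: by end_near. Qed.

(** * Uniqueness of measures from an algebra of bounded functions *)

Lemma bernoulli_le {R : realDomainType} (h : R) n :
  -1 <= h -> 1 + n%:R * h <= (1 + h) ^+ n.
Proof.
move=> h1; elim: n => [|n ih]; first by rewrite mul0r addr0 expr0.
have h0 : 0 <= 1 + h by rewrite -lerBlDl add0r.
rewrite exprS; apply: le_trans (ler_wpM2l h0 ih).
have := mulr_ge0 (ler0n R n) (sqr_ge0 h); rewrite -natr1; nra.
Qed.

(** With w = sqrt r, the factor n w^n stays bounded by Bernoulli's
    inequality, and the remaining factor w^n tends to 0. *)
Lemma cvg_natrMexpr {R : realType} (r : R) : 0 <= r < 1 ->
  n%:R * r ^+ n @[n --> \oo] --> (0 : R).
Proof.
move=> /andP[]; rewrite le_eqVlt => /predU1P[<-|r0] r1.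
  apply: cvg_near_cst; near=> n; rewrite expr0n.
  have /negPf -> : n != 0%N by rewrite -lt0n; near: n; exists 1%N.
  by rewrite mulr0.
pose w := Num.sqrt r.
have w0 : 0 < w by rewrite sqrtr_gt0.
have w1 : w < 1 by rewrite -sqrtr1 ltr_sqrt.
have iw1 : 1 < w^-1 by rewrite invf_gt1.
pose h := w^-1 - 1.
have h0 : 0 < h by rewrite subr_gt0.
have bnd n : n%:R * w ^+ n <= h^-1.
  have := @bernoulli_le _ h n; rewrite [1 + h]addrC subrK => /(_ _)/wrap[].
    by rewrite (le_trans _ (ltW h0))// oppr_le0.
  rewrite exprVn => le1; rewrite -(ler_pM2r h0) mulVf ?gt_eqF//.
  have wn0 : 0 < w ^+ n by rewrite exprn_gt0.
  rewrite mulrAC -ler_pdivlMr// div1r; apply: le_trans le1.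
  by rewrite lerDr.
apply: (@squeeze_cvgr _ _ _ _ (cst 0) (fun n => h^-1 * w ^+ n)).
- near=> n; rewrite mulr_ge0 ?exprn_ge0 ?(ltW r0)//=.
  rewrite -(sqr_sqrtr (ltW r0)) -/w exprAC expr2 mulrA.
  by rewrite ler_wpM2r// exprn_ge0// ltW.
- exact: cvg_cst.
- rewrite -[X in _ --> X](mulr0 h^-1); apply: cvgM; first exact: cvg_cst.
  by apply: cvg_expr; rewrite gtr0_norm.
Unshelve. all: by end_near. Qed.

(** The polynomials of Brosowski and Deutsch: on [0, 1] they converge
    pointwise to the indicator of [0, 1/2[. The factor n in the exponent
    settles the limit at u = 1/2. *)
Definition threshold {R : realType} (u : R) n := (1 - u ^+ n) ^+ (n * 2 ^ n).

Lemma threshold_itv {R : realType} (u : R) n :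
  0 <= u <= 1 -> 0 <= threshold u n <= 1.
Proof.
move=> /andP[u0 u1]; have un0 : 0 <= u ^+ n by rewrite exprn_ge0.
have un1 : u ^+ n <= 1 by rewrite exprn_ile1.
by rewrite exprn_ge0 ?exprn_ile1//; lra.
Qed.

(** Bernoulli's inequality bounds threshold u n below by 1 - n (2 u)^n and
    above by (1 + n 2^n u^n)^-1. *)
Lemma cvg_threshold {R : realType} (u : R) : 0 <= u <= 1 ->
  (threshold u n : R) @[n --> \oo] --> ((u < 1 / 2)%R%:R : R).
Proof.
move=> u01; have /andP[u0 u1] := u01.
have un0 n : 0 <= u ^+ n by rewrite exprn_ge0.
have un1 n : u ^+ n <= 1 by rewrite exprn_ile1.
have [u12|u12] := ltP u (1 / 2).
  apply: (@squeeze_cvgr _ _ _ _ (fun n => 1 - n%:R * (2 * u) ^+ n) (cst 1)).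
  - near=> n; have /andP[_ ->] := threshold_itv u n u01; rewrite andbT.
    have := @bernoulli_le _ (- u ^+ n) (n * 2 ^ n).
    rewrite lerN2 => /(_ (un1 n)); apply: le_trans.
    by rewrite mulrN exprMn mulrA natrM natrX.
  - rewrite -[X in _ --> X]subr0; apply: cvgB; first exact: cvg_cst.
    by apply: cvg_natrMexpr; lra.
  - exact: cvg_cst.
apply: (@squeeze_cvgr _ _ _ _ (cst 0) harmonic).
- near=> n; have /andP[-> _] /= := threshold_itv u n u01.
  have := @bernoulli_le _ (u ^+ n) (n * 2 ^ n).
  rewrite (le_trans _ (un0 n)) ?oppr_le0// => /(_ isT) le1.
  have le2 : n.+1%:R <= (1 + u ^+ n) ^+ (n * 2 ^ n).
    apply: le_trans le1; rewrite -natr1 addrC lerD2l natrM natrX -mulrA -exprMn.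
    by rewrite ler_peMr// exprn_ege1//; lra.
  rewrite -[leRHS]mul1r ler_pdivlMr ?ltr0n//.
  have t0 : 0 <= threshold u n by have /andP[] := threshold_itv u n u01.
  apply: le_trans (ler_wpM2l t0 le2) _.
  rewrite -exprMn exprn_ile1//.
    by rewrite mulr_ge0//; [have := un1 n|have := un0 n]; lra.
  by have := sqr_ge0 (u ^+ n); nra.
- exact: cvg_cst.
- exact: cvg_harmonic.
Unshelve. all: by end_near. Qed.

Lemma bounded_integrable {d} {T : measurableType d} {R : realType}
    (P : probability T R) (f : T -> R) :
  measurable_fun setT f -> (exists M : R, forall x, `|f x| <= M) ->
  P.-integrable setT (EFin \o f).
Proof.
move=> mf [M fM]; apply: measurable_bounded_integrable => //.
  by rewrite (le_lt_trans (probability_le1 _ _))// ltry.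
exists M; split; first exact: num_real.
by move=> N MN x _ /=; rewrite (le_trans (fM x))// ltW.
Qed.

Lemma EFin_Rintegral {d} {T : measurableType d} {R : realType}
    (m : {measure set T -> \bar R}) (f : T -> R) :
  m.-integrable setT (EFin \o f) ->
  (\int[m]_x (f x)%:E)%E = (\int[m]_x f x)%:E.
Proof. by move=> mf; rewrite /Rintegral fineK//; exact: integrable_fin_num. Qed.

Section algebra_uniqueness.
Context d (T : measurableType d) (R : realType) (P Q : probability T R).
Variable A : set (T -> R).
Hypothesis A_cst : forall c, A (cst c).
Hypothesis A_add : forall f g, A f -> A g -> A (fun x => f x + g x).
Hypothesis A_mul : forall f g, A f -> A g -> A (fun x => f x * g x).
Hypothesis A_meas : forall f, A f -> measurable_fun setT f.
Hypothesis A_bdd : forall f, A f -> exists M : R, forall x, `|f x| <= M.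
Hypothesis A_eq : forall f, A f -> \int[P]_x f x = \int[Q]_x f x.

Let approximable := [set C : set T | exists f_ : nat -> T -> R,
  [/\ forall n, A (f_ n), forall n x, 0 <= f_ n x <= 1 &
      forall x, f_ n x @[n --> \oo] --> (\1_C x : R)]].

Let A_exp f n : A f -> A (fun x => f x ^+ n).
Proof.
move=> Af; elim: n => [|n ih].
  by under eq_fun do rewrite expr0; exact: A_cst.
by under eq_fun do rewrite exprS; exact: A_mul.
Qed.

Let approximable_setT : approximable setT.
Proof.
exists (fun _ => cst 1); split => //.
- by move=> n x; rewrite ler01 lexx.
- by move=> x; rewrite indicT; exact: cvg_cst.
Qed.

Let approximable_setI : setI_closed approximable.
Proof.
move=> B C [f [Af f01 fB]] [g [Ag g01 gC]].
exists (fun n x => f n x * g n x); split => [n|n x|x]; first exact: A_mul.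
- have /andP[f0 f1] := f01 n x; have /andP[g0 g1] := g01 n x.
  by rewrite mulr_ge0//= mulr_ile1.
- by rewrite indicI /=; apply: cvgM; [exact: fB|exact: gC].
Qed.

Let approximable_pos f : A f -> approximable [set x | 0 < f x].
Proof.
move=> Af; have [M0 fM0] := A_bdd _ Af.
pose M := Num.max M0 1.
have M_gt0 : 0 < M by rewrite lt_max ltr01 orbT.
have fM x : `|f x| <= M by rewrite le_max fM0.
(* rescaling f to [0, 1] so that 0 < f becomes u < 1/2 *)
pose u x := 1 / 2 + - (2 * M)^-1 * f x.
have Au : A u by apply: A_add; [exact: A_cst|apply: A_mul; [exact: A_cst|]].
have u01 x : 0 <= u x <= 1.
  have := fM x; rewrite ler_norml => /andP[].
  have -> : f x = 2 * M * (1 / 2 - u x).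
    by rewrite /u; field; rewrite gt_eqF.
  move=> h1 h2; apply/andP; split; rewrite -(ler_pM2l M_gt0); lra.
have uE x : (u x < 1 / 2) = (0 < f x).
  rewrite /u gtrDl mulNr oppr_lt0 pmulr_rgt0// invr_gt0; lra.
exists (fun n x => threshold (u x) n); split.
- move=> n; apply: (A_exp (fun x => 1 - u x ^+ n)).
  apply: A_add; first exact: A_cst.
  under eq_fun do rewrite -mulN1r.
  by apply: A_mul; [exact: A_cst|exact: A_exp].
- by move=> n x; exact: threshold_itv.
- move=> x; rewrite indicE [x \in _](_ : _ = (u x < 1 / 2)); last first.
    by rewrite uE; apply/idP/idP; rewrite inE.
  exact: cvg_threshold.
Qed.

Let approximable_measurable C : approximable C -> measurable C.
Proof.
move=> [f [Af _ fC]].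
have mC : measurable_fun setT (\1_C : T -> R).
  apply: (@measurable_fun_cvg _ _ _ _ f) => // n; exact: A_meas.
have -> : C = (\1_C : T -> R) @^-1` [set 1].
  apply/seteqP; split => x /=; rewrite indicE; first by move=> /mem_set ->.
  case: (boolP (x \in C)) => [/set_mem//|_ /eqP].
  by rewrite eq_sym oner_eq0.
by rewrite -[X in measurable X]setTI; exact: mC.
Qed.

Let approximable_eq C : approximable C -> P C = Q C.
Proof.
move=> aC; have mC := approximable_measurable _ aC.
have [f [Af f01 fC]] := aC.
have lim (U : probability T R) :
    (\int[U]_x (f n x)%:E)%E @[n --> \oo] --> U C.
  have -> : U C = (\int[U]_x (\1_C x)%:E)%E by rewrite integral_indic// setIT.
  have [|||||//] := @dominated_convergence _ _ _ U _ measurableT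
    (fun n => EFin \o f n) (fun x => (\1_C x)%:E) (cst 1%E).
  - by move=> n; apply/measurable_EFinP/A_meas.
  - by apply/measurable_EFinP/measurable_indic.
  - by apply: aeW => x _; apply: cvg_EFin; [exact: nearW|exact: fC].
  - exact: finite_measure_integrable_cst.
  - apply: aeW => x n _ /=; have /andP[f0 f1] := f01 n x.
    by rewrite ger0_norm// lee_fin.
have eq_int n : (\int[P]_x (f n x)%:E = \int[Q]_x (f n x)%:E)%E.
  have fint (U : probability T R) : U.-integrable setT (EFin \o f n).
    by apply: bounded_integrable; [exact: A_meas|exact: A_bdd].
  by rewrite (EFin_Rintegral _ _ (fint P)) (EFin_Rintegral _ _ (fint Q)) A_eq.
have := lim P; under eq_fun do rewrite eq_int.
by move=> limP; have := lim Q; exact: cvg_unique.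
Qed.

(** The sets whose indicator is a bounded pointwise limit of elements of A
    form a pi-system, since A is closed under products; P and Q agree on it
    by dominated convergence. The thresholds show that it contains
    {0 < f} for every f in A. *)
Lemma algebra_measure_unique C :
  <<s [set B | exists2 f, A f & B = [set x | 0 < f x]] >> C -> P C = Q C.
Proof.
move=> sC; have sC' : <<s approximable >> C.
  apply: (sub_sigma_algebra2 _ sC) => _ [f Af ->].
  exact: approximable_pos.
apply: (g_sigma_algebra_measure_unique approximable _ (fun _ => setT)) => //.
- by rewrite bigcup_const//; exists 0%N.
- by move=> _; rewrite (le_lt_trans (probability_le1 _ _))// ltry.
Qed.

End algebra_uniqueness.

(** * Uniqueness of measures from characteristic functions *)

(** Phases b are kept inside the cosine so that sines need no constructor
    of their own. *)
Inductive trig_poly {T : Type} {R : realType} (L : set (T -> R)) :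
    set (T -> R) :=
| trig_poly_cos a b l : L l -> trig_poly L (fun x => a * cos (l x + b))
| trig_poly_add f g : trig_poly L f -> trig_poly L g ->
    trig_poly L (fun x => f x + g x).

Lemma cosMcos {R : realType} (x y : R) :
  cos x * cos y = 1 / 2 * cos (x + y) + 1 / 2 * cos (x - y).
Proof. by rewrite cosD cosB; lra. Qed.

Lemma trig_poly_mul {T : Type} {R : realType} (L : set (T -> R)) :
  (forall a l l', L l -> L l' -> L (fun x => a * l x + l' x)) ->
  forall f g, trig_poly L f -> trig_poly L g ->
    trig_poly L (fun x => f x * g x).
Proof.
move=> Llin f g + Lg; elim=> [a b l Ll|f1 f2 _ ih1 _ ih2]; last first.
  rewrite (_ : (fun x => _) = (fun x => f1 x * g x + f2 x * g x)).
    exact: trig_poly_add.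
  by apply/funext => x; rewrite mulrDl.
elim: Lg => [a' b' l' Ll'|g1 g2 _ ih1 _ ih2]; last first.
  rewrite (_ : (fun x => _) = (fun x => a * cos (l x + b) * g1 x +
    a * cos (l x + b) * g2 x)); first exact: trig_poly_add.
  by apply/funext => x; rewrite mulrDr.
rewrite (_ : (fun x => _) = (fun x =>
    a * a' / 2 * cos ((1 * l x + l' x) + (b + b')) +
    a * a' / 2 * cos ((-1 * l' x + l x) + (b - b')))).
  by apply: trig_poly_add; apply: trig_poly_cos; exact: Llin.
apply/funext => x; rewrite mulrACA cosMcos.
rewrite (_ : 1 * l x + _ + _ = (l x + b) + (l' x + b')); last by ring.
rewrite (_ : -1 * l' x + _ + _ = (l x + b) - (l' x + b')); last by ring.
by field.
Qed.

(** Used to recover the half-line {c < l} from sines: for large n the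
    point (l - c) / (n + 1) lies in ]-pi, pi[, where sin has the sign of its
    argument. *)
Lemma sin_gt0_eventually {R : realType} (y : R) :
  (\forall n \near \oo, 0 < sin (y / n.+1%:R)) <-> 0 < y.
Proof.
have npos n : 0 < n.+1%:R^-1 :> R by rewrite invr_gt0 ltr0n.
have small z : 0 < z -> \forall n \near \oo, 0 < sin (z / n.+1%:R) :> R.
  move=> z0; have pz : 0 < pi / z :> R by rewrite divr_gt0 ?pi_gt0.
  near=> n; apply: sin_gt0_pi; rewrite divr_gt0 ?ltr0n//=.
  rewrite mulrC -ltr_pdivlMr//.
  near: n; exact: (near_infty_natSinv_lt (PosNum pz)).
split; last exact: small.
have [//|+ [N _ yP]] := ltP 0 y; rewrite le_eqVlt => /predU1P[y0|y0].
  by have := yP N (leqnn N); rewrite /= y0 mul0r sin0 ltxx.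
have [M _ zP] := small (- y) (ltac:(rewrite oppr_gt0//)).
have := yP _ (leq_maxl N M); have := zP _ (leq_maxr N M).
by rewrite /= mulNr sinN oppr_gt0 => /lt_trans/[apply]; rewrite ltxx.
Unshelve. all: by end_near. Qed.

Section charfun_uniqueness.
Context d (T : measurableType d) (R : realType) (P Q : probability T R).
Variable L : set (T -> R).
Hypothesis L0 : L (fun=> 0).
Hypothesis L_lin : forall a l l', L l -> L l' -> L (fun x => a * l x + l' x).
Hypothesis L_meas : forall l, L l -> measurable_fun setT l.
Hypothesis L_eq : forall l b, L l ->
  \int[P]_x cos (l x + b) = \int[Q]_x cos (l x + b).

Let trig_meas f : trig_poly L f -> measurable_fun setT f.
Proof.
elim=> [a b l Ll|f1 f2 _ m1 _ m2]; last exact: measurable_funD.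
apply: measurable_funM => //; apply: measurableT_comp.
  by apply: continuous_measurable_fun; exact: continuous_cos.
by apply: measurable_funD => //; exact: L_meas.
Qed.

Let trig_bdd f : trig_poly L f -> exists M : R, forall x, `|f x| <= M.
Proof.
elim=> [a b l Ll|f1 f2 _ [M1 h1] _ [M2 h2]].
  exists `|a| => x; rewrite normrM ler_piMr// ler_norml.
  by rewrite cos_geN1 cos_le1.
by exists (M1 + M2) => x; rewrite (le_trans (ler_normD _ _))// lerD.
Qed.

Let trig_integrable (U : probability T R) f :
  trig_poly L f -> U.-integrable setT (EFin \o f).
Proof.
by move=> tf; apply: bounded_integrable; [exact: trig_meas|exact: trig_bdd].
Qed.

Let trig_eq f : trig_poly L f -> \int[P]_x f x = \int[Q]_x f x.
Proof.
elim=> [a b l Ll|f1 f2 t1 e1 t2 e2]; last first.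
  by rewrite !RintegralD ?e1 ?e2//; exact: trig_integrable.
have t1 : trig_poly L (fun x => cos (l x + b)).
  rewrite (_ : (fun _ => _) = (fun x => 1 * cos (l x + b))).
    exact: trig_poly_cos.
  by apply/funext => x; rewrite mul1r.
by rewrite !RintegralZl ?L_eq//; exact: trig_integrable.
Qed.

Let L_scale a l : L l -> L (fun x => a * l x).
Proof.
by move=> Ll; under eq_fun do rewrite -[_ * _]addr0; exact: L_lin.
Qed.

(** L is closed under scaling, so the sets {0 < sin ((l - c) / (n + 1))} are
    available for every n, and {c < l} is their limit inferior. *)
Lemma charfun_measure_unique C :
  <<s [set B | exists2 l, L l & exists c, B = [set x | c < l x]] >> C ->
  P C = Q C.
Proof.
move=> sC; apply: (algebra_measure_unique _ _ _ P Q (trig_poly L)) => //.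
- move=> c; rewrite (_ : cst c = (fun x => c * cos (0 + 0))).
    exact: (trig_poly_cos _ c 0 (fun=> 0)).
  by apply/funext => x; rewrite addr0 cos0 mulr1.
- exact: trig_poly_add.
- exact: trig_poly_mul.
set G := [set B | _].
suff LG : [set B | exists2 l, L l & exists c, B = [set x | c < l x]] `<=`
    <<s G >>.
  apply: (smallest_sub _ LG sC); exact: smallest_sigma_algebra.
move=> _ [l Ll [c ->]].
pose S n := [set x | 0 < sin ((l x - c) / n.+1%:R)].
have -> : [set x | c < l x] = \bigcup_N \bigcap_(n in [set n | (N <= n)%N]) S n.
  apply/seteqP; split => x /=.
    rewrite -subr_gt0 => /sin_gt0_eventually[N _ hN].
    by exists N => // n Nn; exact: hN.
  move=> [N _ hN]; rewrite -subr_gt0; apply/sin_gt0_eventually.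
  by exists N => // n Nn; exact: hN.
have SG n : @measurable _ (g_sigma_algebraType G) (S n).
  apply: sub_sigma_algebra.
  exists (fun x => 1 * cos (n.+1%:R^-1 * l x + (- c / n.+1%:R - pi / 2))).
    by apply: trig_poly_cos; exact: L_scale.
  apply/funext => x; rewrite /S/= mul1r -cosBpihalf; congr (is_true (0 < cos _)).
  by rewrite mulrBl addrA; congr (_ + _ - _); [rewrite mulrC|rewrite mulNr].
apply: (@bigcupT_measurable _ (g_sigma_algebraType G)) => N.
apply: (@bigcap_measurable _ (g_sigma_algebraType G)); first by exists N => /=.
by move=> n _; exact: SG.
Qed.

End charfun_uniqueness.

(** * Borel sets of a separable normed space *)

Lemma continuous_borel_measurable {R : realType} {E : normedModType R}
    (f : E -> R) :
  continuous f -> measurable_fun setT (f : borel E -> R).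
Proof.
move=> cf; apply: (measurability _ (RGenOInfty.measurableE R)) => //.
move=> _ [_ [a ->] <-]; rewrite setTI; apply: sub_sigma_algebra.
have /continuousP := cf; apply; exact: interval_open.
Qed.

Lemma measurable_norm_gt {R : realType} {E : normedModType R} (u : R) :
  measurable ([set x : E | u < `|x|] : set (borel E)).
Proof.
apply: sub_sigma_algebra; have /continuousP norm_open := @norm_continuous R E.
exact: (norm_open [set y | u < y] (@open_gt R u)).
Qed.

(** Closed balls are countable intersections of half-spaces, and an open set
    of a separable space is a countable union of closed balls. *)
Lemma measurable_fun_borel {R : realType} {E : normedModType R}
    {d} {T : measurableType d} (f : T -> borel E) :
  separable E ->
  (forall l : E -> R, linear (l : E -> R^o) -> continuous l ->
     measurable_fun setT (l \o f)) ->
  measurable_fun setT f.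
Proof.
move=> sepE mlf; have [g dg] := separable_dense_sequence _ sepE.
have [h [hlin hcont hnorm]] := norming_sequence _ sepE.
have mball a r : measurable [set t | `|(f t : E) - a| <= r].
  have -> : [set t | `|(f t : E) - a| <= r] =
      \bigcap_n ((h n \o f) @^-1` `]-oo, r + h n a]).
    apply/seteqP; split => [t /= /hnorm ta n _|t ta]; last first.
      apply/hnorm => n; have := ta n I; rewrite /= in_itv/=.
      by rewrite linear_formB// lerBlDr.
    by have := ta n; rewrite /= in_itv/= linear_formB// lerBlDr.
  apply: bigcapT_measurable => n; rewrite -[X in measurable X]setTI.
  exact: mlf.
apply: (@measurability _ _ T (borel E) setT f (@open E)); first by [].
move=> _ [U oU <-]; rewrite setTI.
pose K n := [set k | [set x : E | `|x - g n| <= k.+1%:R^-1] `<=` U].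
have -> : f @^-1` U = \bigcup_n \bigcup_(k in K n)
    [set t | `|(f t : E) - g n| <= k.+1%:R^-1].
  apply/seteqP; split => [t Ut|t [n _ [k Kk]]]; last exact: Kk.
  have /nbhs_ballP[e /= e0 eU] : nbhs (f t : E) U by exact: open_nbhs_nbhs.
  have e20 : 0 < e / 2 by rewrite divr_gt0.
  have [k _ kP] := near_infty_natSinv_lt (PosNum e20).
  have ke : k.+1%:R^-1 < e / 2 by exact: kP (leqnn k).
  have k0 : 0 < k.+1%:R^-1 :> R by rewrite invr_gt0.
  have [y [fg [n _ gn]]] : (ball (f t : E) k.+1%:R^-1 `&` range g) !=set0.
    by apply: dg; [exists (f t); exact: ballxx|exact: ball_open].
  move: fg; rewrite -gn -ball_normE /= => fg.
  exists n => //; exists k; last exact: ltW.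
  move=> x /= xg; apply: eU; rewrite -ball_normE /=.
  apply: le_lt_trans (ler_distD (g n) _ _) _.
  rewrite (distrC (g n)); apply: lt_le_trans (ltr_leD fg xg) _.
  by rewrite [leRHS]splitr lerD ?(ltW ke).
apply: bigcupT_measurable => n; apply: bigcup_measurable => k _.
exact: mball.
Qed.

(** * The centered normal law on the line *)

Section normal_law.
Context {R : realType} (s : R).
Hypothesis s0 : 0 < s.
Local Notation mu := (@lebesgue_measure R).
Local Notation p := (normal_pdf 0 s).
Local Notation N := (normal_prob 0 s).

Let sN0 : s != 0. Proof. by rewrite gt_eqF. Qed.

Lemma ge0_integral_normal_prob (f : R -> \bar R) :
  measurable_fun setT f -> (forall x, 0 <= f x)%E ->
  (\int[N]_x f x = \int[mu]_x (f x * (p x)%:E))%E.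
Proof.
move=> mf f0; have dom := normal_prob_dominates 0 s.
rewrite -(Radon_Nikodym_SigmaFinite.change_of_variables dom f0 measurableT mf).
have intRN := Radon_Nikodym_SigmaFinite.f_integrable dom.
have mp : measurable_fun setT (fun x => (p x)%:E).
  by apply/measurable_EFinP; exact: measurable_normal_pdf.
have mRN := measurable_int _ intRN.
apply: ae_eq_integral => //; [exact: emeasurable_funM|exact: emeasurable_funM|].
apply: ae_eqe_mul2l; apply: integral_ae_eq => //.
by move=> E _ mE; rewrite -Radon_Nikodym_SigmaFinite.f_integral.
Qed.

Lemma integrable_normal_probP (f : R -> R) : measurable_fun setT f ->
  N.-integrable setT (EFin \o f) <->
  mu.-integrable setT (fun x => (f x * p x)%:E).
Proof.
move=> mf.
have E : (\int[N]_x `|(f x)%:E| = \int[mu]_x `|(f x * p x)%:E|)%E.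
  rewrite ge0_integral_normal_prob//; last first.
    by apply: measurableT_comp => //; exact/measurable_EFinP.
  apply: eq_integral => x _.
  by rewrite EFinM abseM (gee0_abs (_ : 0 <= (p x)%:E)%E)// lee_fin normal_pdf_ge0.
split => /integrableP[m fi]; apply/integrableP; split.
- by apply/measurable_EFinP/measurable_funM => //; exact: measurable_normal_pdf.
- by rewrite -E.
- exact/measurable_EFinP.
- by rewrite E.
Qed.

Lemma Rintegral_normal_prob (f : R -> R) : measurable_fun setT f ->
  N.-integrable setT (EFin \o f) ->
  \int[N]_x f x = \int[mu]_x (f x * p x).
Proof.
move=> mf fi; rewrite /Rintegral; congr fine.
rewrite integralE [RHS]integralE; congr (_ - _)%E;
  rewrite ge0_integral_normal_prob//.
- apply: eq_integral => x _.
  rewrite !funeposE -!EFin_max -EFinM maxr_pMl ?normal_pdf_ge0//.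
  by rewrite mul0r.
- by apply: measurable_funepos; exact/measurable_EFinP.
- apply: eq_integral => x _.
  rewrite !funenegE -!EFinN -!EFin_max -EFinM maxr_pMl ?normal_pdf_ge0//.
  by rewrite mul0r mulNr.
- by apply: measurable_funeneg; exact/measurable_EFinP.
Qed.

(** Completing the square. This is what makes exp(u x), hence every
    polynomial, integrable under the normal law. *)
Lemma expR_normal_pdf (u x : R) :
  expR (u * x) * p x = expR (u ^+ 2 * s ^+ 2 / 2) * normal_pdf (u * s ^+ 2) s x.
Proof.
rewrite !normal_pdfE// /normal_fun mulrCA [RHS]mulrCA; congr (_ * _).
rewrite -!expRD; congr expR; rewrite -(mulr_natr (s ^+ 2)); field.
by rewrite sN0.
Qed.

Lemma integrable_sqr_normal : N.-integrable setT (fun x => (x ^+ 2)%:E).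
Proof.
have mf : measurable_fun setT (fun x : R => x ^+ 2) by exact: measurable_funX.
apply/(integrable_normal_probP _ mf).
pose c u := expR (u ^+ 2 * s ^+ 2 / 2) : R.
apply: (@le_integrable _ _ _ mu _ measurableT _ (fun x =>
    (2 * c 1)%:E * (normal_pdf (1 * s ^+ 2) s x)%:E +
    (2 * c (-1))%:E * (normal_pdf (-1 * s ^+ 2) s x)%:E)%E).
- apply/measurable_EFinP/measurable_funM => //; exact: measurable_normal_pdf.
- move=> x _.
  rewrite -!EFinM -EFinD abse_EFin lee_fin -(mulrA 2 (c 1)) -(mulrA 2 (c (-1))).
  rewrite -(expR_normal_pdf 1 x) -(expR_normal_pdf (-1) x).
  rewrite -(mulrDr 2) -(mulrDl _ _ (p x)).
  have p0 := normal_pdf_ge0 0 s x.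
  rewrite (ger0_norm (mulr_ge0 (sqr_ge0 x) p0)) ger0_norm; last first.
    by rewrite mulr_ge0// mulr_ge0// addr_ge0// expR_ge0.
  rewrite mulrA ler_wpM2r// mul1r mulN1r.
  have e1 := expR_ge0 x; have e2 := expR_ge0 (- x).
  have half (y : R) : 0 <= y -> y ^+ 2 <= 2 * expR y.
    by move=> y0; have := expR_ge1Dxn 1 y0; rewrite (_ : 2`!%:R = 2)//; lra.
  have [x0|/ltW x0] := leP 0 x; first by have := half _ x0; lra.
  by have := half (- x); rewrite oppr_ge0 sqrrN => /(_ x0); lra.
- by apply: integrableD => //; apply: integrableZl => //;
    exact: integrable_normal_pdf.
Qed.

Lemma integrable_quadratic_growth (f : R -> R) (C : R) :
  measurable_fun setT f -> (forall x, `|f x| <= C * (1 + x ^+ 2)) ->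
  N.-integrable setT (EFin \o f).
Proof.
move=> mf fC.
apply: (@le_integrable _ _ _ N _ measurableT _ (fun x =>
    C%:E * (cst 1%E x + (x ^+ 2)%:E))%E).
- exact/measurable_EFinP.
- move=> x _; rewrite -EFinD -EFinM !abse_EFin lee_fin (le_trans (fC x))//.
  exact: ler_norm.
- apply: integrableZl => //; apply: integrableD => //.
  + exact: finite_measure_integrable_cst.
  + exact: integrable_sqr_normal.
Qed.

Lemma is_derive_normal_pdf (x : R) : is_derive x 1 p (- x / s ^+ 2 * p x).
Proof.
rewrite normal_pdfE// /normal_fun.
have -> : (fun x => normal_peak s * expR (- (x - 0) ^+ 2 / (s ^+ 2 *+ 2))) =
    (fun x => normal_peak s * expR (- (x ^+ 2) * (s ^+ 2 *+ 2)^-1)).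
  by apply/funext => y; rewrite subr0.
apply: is_derive_eq; rewrite subr0 /GRing.scale/= -(mulr_natr (s ^+ 2)); field.
by rewrite sN0.
Qed.

(** Makes the boundary terms of the integration by parts in [stein] vanish
    for integrands of linear growth. *)
Lemma normal_pdf_decay n :
  (1 + n.+1%:R) * p n.+1%:R <= 4 * s ^+ 2 * normal_peak s * harmonic n.
Proof.
rewrite normal_pdfE// /normal_fun subr0 /harmonic /=.
set a : R := n.+1%:R; have a1 : 1 <= a by rewrite ler1n.
have a0 : 0 < a by rewrite ltr0n.
rewrite mulrCA [leRHS]mulrAC [leRHS]mulrC ler_wpM2l ?normal_peak_ge0//.
rewrite mulNr expRN ler_pdivrMr ?expR_gt0//.
set y := a ^+ 2 / _.
have ey : y <= expR y by apply: le_trans (expR_ge1Dx y); rewrite lerDr.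
have c0 : 0 <= 4 * s ^+ 2 / a by rewrite divr_ge0 ?mulr_ge0 ?sqr_ge0 ?ltW.
apply: le_trans (ler_wpM2l c0 ey).
rewrite (_ : _ * y = 2 * a); first by lra.
by rewrite /y -(mulr_natr (s ^+ 2)); field; rewrite sN0 gt_eqF.
Qed.

Lemma normal_pdf_even x : p (- x) = p x.
Proof. by rewrite !normal_pdfE// /normal_fun !subr0 sqrrN. Qed.

Lemma Rintegral_derive_vanishing (H h : R -> R) :
  (forall x : R, is_derive x 1 H (h x)) -> continuous h ->
  mu.-integrable setT (EFin \o h) ->
  (H n.+1%:R - H (- n.+1%:R)) @[n --> \oo] --> 0 ->
  \int[mu]_x h x = 0.
Proof.
move=> dH ch ih Hlim.
pose I n := `[- n.+1%:R, n.+1%:R]%classic : set R.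
pose f n x := ((h x) * \1_(I n) x)%:E.
have mh : measurable_fun setT h by exact: continuous_measurable_fun.
have mI n : measurable (I n) by exact: measurable_itv.
have fE n : (\int[mu]_x f n x = (H n.+1%:R - H (- n.+1%:R))%:E)%E.
  rewrite EFinB -(@continuous_FTC2 _ h).
  - rewrite [RHS]integral_mkcond; apply: eq_integral => x _.
    by rewrite /f /I patchE indicE; case: ifP => _; rewrite ?mulr1 ?mulr0.
  - by rewrite gtrN.
  - exact: continuous_subspaceT.
  - split.
    + by move=> x _; exact: ex_derive.
    + apply: cvg_at_right_filter; apply: differentiable_continuous.
      by apply/derivable1_diffP; exact: ex_derive.
    + apply: cvg_at_left_filter; apply: differentiable_continuous.
      by apply/derivable1_diffP; exact: ex_derive.
  - by move=> x _; rewrite derive1E; exact: derive_val.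
have [|||||_ _] := @dominated_convergence _ _ _ mu _ measurableT f
  (EFin \o h) (fun x => `|h x|%:E).
- move=> n; apply/measurable_EFinP/measurable_funM => //.
  by apply: measurable_indic; exact: mI.
- exact/measurable_EFinP.
- apply: aeW => x _; apply: cvg_EFin; first exact: nearW.
  apply: cvg_near_cst; near=> n; rewrite /f /= indicE mem_set ?mulr1//.
  rewrite /I /= in_itv/= -ler_norml; near: n.
  exists (Num.truncn `|x|) => // n /= xn.
  by rewrite (le_trans (ltW (truncnS_gt _)))// ler_nat.
- exact: integrable_norm.
- apply: aeW => x n _; rewrite /f /= lee_fin normrM ler_piMr//.
  by rewrite indicE; case: (_ \in _); rewrite ?normr1 ?normr0.
under eq_fun do rewrite fE.
move=> lim1; rewrite /Rintegral.
have lim2 : (H n.+1%:R - H (- n.+1%:R))%:E @[n --> \oo] --> (0%:E : \bar R).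
  by apply: cvg_EFin => //; exact: nearW.
by rewrite (cvg_unique _ lim1 lim2).
Unshelve. all: by end_near. Qed.

(** Since (g p)' = g' p - x g p / s^2 for the density p, and g p vanishes at
    infinity, the integral of the right-hand side is 0. *)
Lemma stein (g g' : R -> R) (C : R) :
  (forall x : R, is_derive x 1 g (g' x)) -> continuous g' ->
  (forall x, `|g x| <= C * (1 + `|x|)) -> (forall x, `|g' x| <= C) ->
  \int[N]_x (x * g x) = s ^+ 2 * \int[N]_x g' x.
Proof.
move=> dg cg' gC g'C.
have cg : continuous g.
  move=> x; apply: differentiable_continuous; apply/derivable1_diffP.
  exact: ex_derive.
have C0 : 0 <= C by rewrite (le_trans _ (g'C 0)).
have mg : measurable_fun setT g by exact: continuous_measurable_fun.
have mg' : measurable_fun setT g' by exact: continuous_measurable_fun.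
have mxg : measurable_fun setT (fun x : R => x * g x) by exact: measurable_funM.
have ig' : N.-integrable setT (EFin \o g').
  apply: (integrable_quadratic_growth _ C) => // x; rewrite (le_trans (g'C x))//.
  by rewrite ler_peMr// lerDl sqr_ge0.
have ixg : N.-integrable setT (EFin \o (fun x : R => x * g x)).
  apply: (integrable_quadratic_growth _ (2 * C)) => // x; rewrite normrM.
  apply: le_trans (ler_wpM2l (normr_ge0 _) (gC x)) _.
  rewrite -(real_normK (num_real x)).
  have := mulr_ge0 C0 (sqr_ge0 (`|x| - 1)); have := normr_ge0 x; nra.
pose h x := g' x * p x - (s ^+ 2)^-1 * ((x * g x) * p x).
have i1 := (integrable_normal_probP _ mg').1 ig'.
have i2 := (integrable_normal_probP _ mxg).1 ixg.
have i3 : mu.-integrable setT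
    (EFin \o (fun x : R => (s ^+ 2)^-1 * ((x * g x) * p x))).
  by rewrite /comp; under eq_fun do rewrite EFinM; exact: integrableZl.
have ih : mu.-integrable setT (EFin \o h).
  by rewrite /h /comp; under eq_fun do rewrite EFinB; exact: integrableB.
have : \int[mu]_x h x = 0.
  apply: (Rintegral_derive_vanishing (fun x => g x * p x)) => //.
  - move=> x; have dp := is_derive_normal_pdf x.
    apply: is_derive_eq; rewrite /h /GRing.scale/=; field; exact: sN0.
  - have cp := @continuous_normal_pdf R 0 s sN0.
    move=> x; apply: cvgB; first by apply: cvgM; [exact: cg'|exact: cp].
    apply: cvgM; first exact: cvg_cst.
    apply: cvgM; last exact: cp.
    by apply: cvgM; [exact: cvg_id|exact: cg].
  - apply: norm_cvg0.
    pose K := 2 * (C * (4 * s ^+ 2 * normal_peak s)).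
    apply: (@squeeze_cvgr _ _ _ _ (cst 0) (fun n => K * harmonic n)).
    + apply: nearW => n /=; rewrite normr_ge0/=.
      have dec := normal_pdf_decay n.
      apply: le_trans (ler_normB _ _) _; rewrite !normrM normal_pdf_even.
      rewrite (ger0_norm (normal_pdf_ge0 _ _ _)) -mulrDl.
      have p0 := normal_pdf_ge0 0 s n.+1%:R.
      have h1 := gC n.+1%:R; have := gC (- n.+1%:R).
      rewrite normrN (ger0_norm (ler0n _ _)) in h1 * => h2.
      apply: le_trans (ler_wpM2r p0 (lerD h1 h2)) _.
      rewrite [leLHS](_ : _ = 2 * (C * ((1 + n.+1%:R) * p n.+1%:R))); last by ring.
      have -> : K * harmonic n =
          2 * (C * (4 * s ^+ 2 * normal_peak s * harmonic n)).
        by rewrite /K; ring.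
      by rewrite ler_wpM2l// ler_wpM2l.
    + exact: cvg_cst.
    + rewrite -[X in _ --> X](mulr0 K); apply: cvgM; first exact: cvg_cst.
      exact: cvg_harmonic.
rewrite /h RintegralB//.
rewrite RintegralZl// -!Rintegral_normal_prob// => /subr0_eq ->.
by rewrite mulVKf// expf_neq0.
Qed.

Lemma normal_moment2 : \int[N]_x (x ^+ 2) = s ^+ 2.
Proof.
have h := stein id (cst 1) 1.
rewrite (_ : (fun x => x ^+ 2) = (fun x : R => x * id x)); last first.
  by apply/funext => x; rewrite expr2.
rewrite h.
- by rewrite Rintegral_cst// mul1r [X in fine X]probability_setT mulr1.
- by move=> x; exact: cvg_cst.
- by move=> x; rewrite mul1r lerDr.
- by move=> x; rewrite normr1.
Qed.

(** K(u) = E cos(u x + b) has K'(u) = - E x sin(u x + b), which equals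
    - u s^2 K(u) by [stein], so K(u) exp(u^2 s^2 / 2) is constant. The phase b
    treats the cosine and the sine together. *)
Lemma normal_charfun (u b : R) :
  \int[N]_x cos (u * x + b) = cos b * expR (- (u ^+ 2 * s ^+ 2 / 2)).
Proof.
pose f (v x : R) := cos (v * x + b).
pose K v := \int[N]_x f v x.
have maff v : measurable_fun setT (fun x : R => v * x + b).
  by apply: measurable_funD => //; exact: measurable_funM.
have mf v : measurable_fun setT (f v).
  apply: measurableT_comp (maff v).
  by apply: continuous_measurable_fun; exact: continuous_cos.
have fi v : N.-integrable setT (EFin \o f v).
  apply: bounded_integrable; [exact: mf|exists 1 => x].
  by rewrite ler_norml cos_geN1 cos_le1.
have df (v x : R) : is_derive v 1 (f ^~ x) (- (x * sin (v * x + b))).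
  by rewrite /f; apply: is_derive_eq; rewrite /GRing.scale/=; ring.
have d1E (v x : R) : partial1of2 f v x = - (x * sin (v * x + b)).
  by rewrite /partial1of2 derive1E; exact: derive_val.
have normi : N.-integrable setT (fun x => `|x|%:E).
  apply: (integrable_quadratic_growth (fun x => `|x|) 1).
    exact: measurableT_comp.
  move=> x; rewrite normr_id mul1r -(real_normK (num_real x)).
  by have := sqr_ge0 (`|x| - 1); have := normr_ge0 x; nra.
have sin_le (y : R) : `|sin y| <= 1 by rewrite ler_norml sin_geN1 sin_le1.
have vI (v : R) : `]v - 1, v + 1[%classic v.
  by rewrite /= in_itv/= gtrBl ltrDl ltr01.
have Gub w x : `|partial1of2 f w x| <= `|x|.
  by rewrite d1E normrN normrM ler_piMr.
have KE v : derive1 K v = \int[N]_x (- (x * sin (v * x + b))).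
  rewrite (@differentiation_under_integral _ _ _ N f setT measurableT v _ _
    (vI v)
    (fun w _ => fi w) (fun w x _ _ => ex_derive) (fun x => `|x|)) //.
  by apply: eq_Rintegral => x _; exact: d1E.
have Kd (v : R) : derivable K v 1.
  apply: (@derivable_under_integral _ _ _ N f setT measurableT v _ _ (vI v)
    (fun w _ => fi w) (fun w x _ _ => ex_derive) (fun x => `|x|)) => //.
have Kode (v : R) : is_derive v 1 K (- (v * s ^+ 2 * K v)).
  apply: DeriveDef; first exact: Kd.
  rewrite -derive1E KE.
  rewrite (_ : (fun x => _) = (fun x => -1 * (x * sin (v * x + b)))); last first.
    by apply/funext => x; rewrite mulN1r.
  have C1 : 1 <= `|v| + 1 by rewrite lerDr.
  have msin : measurable_fun setT (fun x : R => x * sin (v * x + b)).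
    apply: measurable_funM => //; apply: measurableT_comp (maff v).
    by apply: continuous_measurable_fun; exact: continuous_sin.
  rewrite RintegralZl//; last first.
    apply: (integrable_quadratic_growth _ 1) => // x.
    rewrite normrM mul1r -(real_normK (num_real x)).
    apply: le_trans (ler_wpM2l (normr_ge0 x) (sin_le _)) _.
    by have := sqr_ge0 (`|x| - 1); have := normr_ge0 x; nra.
  suff -> : \int[N]_x (x * sin (v * x + b)) = s ^+ 2 * \int[N]_x (v * f v x).
    by rewrite RintegralZl// -/(K v); ring.
  apply: (stein (fun x => sin (v * x + b)) (fun x => v * f v x) (`|v| + 1)).
  - by move=> x; apply: is_derive_eq; rewrite /f /GRing.scale/=; ring.
  - move=> x; apply: cvgM; first exact: cvg_cst.
    apply: (@cvg_comp _ _ _ _ cos); last exact: continuous_cos.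
    apply: cvgD; last exact: cvg_cst.
    by apply: cvgM; [exact: cvg_cst|exact: cvg_id].
  - move=> x; rewrite (le_trans (sin_le _))// (le_trans C1)//.
    by rewrite ler_peMr ?lerDl// addr_ge0.
  - move=> x; rewrite normrM (le_trans (_ : _ <= `|v|)) ?lerDl//.
    by rewrite ler_piMr// ler_norml cos_geN1 cos_le1.
pose M v := K v * expR (v ^+ 2 * s ^+ 2 / 2).
have Mcst : M u = M 0.
  apply: is_derive_0_is_cst => v; have := Kode v => ?.
  by apply: is_derive_eq; rewrite /GRing.scale/=; field.
have K0 : K 0 = cos b.
  rewrite /K /f; under eq_Rintegral do rewrite mul0r add0r.
  by rewrite Rintegral_cst// [X in fine X]probability_setT mulr1.
move: Mcst; rewrite /M expr0n/= !mul0r expR0 mulr1 K0 => <-.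
by rewrite expRN mulfK// gt_eqF// expR_gt0.
Qed.

End normal_law.

(** * Gaussian measures through their functionals *)

(** Change of variables for a law known only through its values on
    measurable sets. The positive and negative parts are transported
    separately, so f is an arbitrary measurable function. *)
Lemma integral_law {d} {T : measurableType d} {d'} {T' : measurableType d'}
    {R : realType} (m : {measure set T -> \bar R}) (X : T -> T')
    (nu : {measure set T' -> \bar R}) :
  measurable_fun setT X ->
  (forall B, measurable B -> pushforward m X B = nu B) ->
  forall f : T' -> \bar R, measurable_fun setT f ->
  (\int[m]_x f (X x) = \int[nu]_y f y)%E.
Proof.
move=> mX lawX.
have ge0 (f : T' -> \bar R) : measurable_fun setT f ->
    (forall y, 0 <= f y)%E -> (\int[m]_x f (X x) = \int[nu]_y f y)%E.
  move=> mf f0; rewrite -(preimage_setT X) -[LHS]/(\int[m]_(x in _) (f \o X) x)%E.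
  rewrite -(ge0_integral_pushforward mX)//.
  by apply: eq_measure_integral => B mB _; exact: lawX.
move=> f mf; rewrite integralE [RHS]integralE -!ge0//.
- by congr (_ - _)%E; apply: eq_integral => x _; rewrite ?funeposE ?funenegE.
- exact: measurable_funeneg.
- exact: measurable_funepos.
Qed.

(** Both cases of the law, normal and Dirac, are covered by the single
    formula in terms of the second moment. *)
Lemma gaussian_functional {R : realType} {E : completeNormedModType R}
    (m : probability (borel E) R) (l : E -> R) :
  centered_gaussian m -> linear (l : E -> R^o) -> continuous l ->
  m.-integrable setT (fun x => (l x ^+ 2)%:E) /\
  forall b, \int[m]_x cos (l x + b) =
    cos b * expR (- (\int[m]_x (l x ^+ 2)) / 2).
Proof.
move=> gm ll lc.
have ml : measurable_fun setT (l : borel E -> measurableTypeR R).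
  exact: continuous_borel_measurable.
pose th : {linear E -> R^o} := HB.pack (l : E -> R^o)
  (GRing.isLinear.Build _ _ _ _ (l : E -> R^o) ll).
have msqr : measurable_fun setT (fun y : R => y ^+ 2) by exact: measurable_funX.
have msqrl : measurable_fun setT (fun x : borel E => l x ^+ 2).
  exact: measurableT_comp msqr ml.
have mcos b : measurable_fun setT (fun y : R => cos (y + b)).
  apply: measurableT_comp; last exact: measurable_funD.
  by apply: continuous_measurable_fun; exact: continuous_cos.
have law (nu : {measure set (measurableTypeR R) -> \bar R}) :
    (forall B, measurable B ->
      pushforward m (l : borel E -> measurableTypeR R) B = nu B) ->
    forall f : R -> R, measurable_fun setT f ->
    (\int[m]_x (f (l x))%:E = \int[nu]_y (f y)%:E)%E.
  by move=> lawl f mf; apply: (integral_law _ _ _ ml lawl (EFin \o f));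
    exact/measurable_EFinP.
have [[s s0 lawl]|lawl] := gm th lc.
- have lawf := law _ lawl; split.
    apply/integrableP; split; first exact/measurable_EFinP.
    have /integrableP[_] := integrable_sqr_normal _ s0.
    apply: le_lt_trans.
    under eq_integral do rewrite abse_EFin ger0_norm ?sqr_ge0//.
    under [leRHS]eq_integral do rewrite abse_EFin ger0_norm ?sqr_ge0//.
    by rewrite (lawf _ msqr).
  have lawR (f : R -> R) : measurable_fun setT f ->
      \int[m]_x f (l x) = \int[normal_prob 0 s]_y f y.
    by move=> mf; rewrite /Rintegral lawf.
  move=> b; rewrite (lawR _ (mcos b)) (lawR _ msqr) (normal_moment2 _ s0).
  have := normal_charfun _ s0 1 b.
  under eq_Rintegral do rewrite mul1r.
  by move=> ->; rewrite expr1n mul1r mulNr.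
- have lawf := law [the {measure set (measurableTypeR R) -> \bar R} of
    \d_(0 : measurableTypeR R)] lawl.
  have diracE (f : R -> R) : measurable_fun setT f ->
      (\int[m]_x (f (l x))%:E = (f 0)%:E)%E.
    move=> mf; rewrite (lawf _ mf) integral_dirac//; last exact/measurable_EFinP.
    by rewrite diracT mul1e.
  split.
    apply/integrableP; split; first exact/measurable_EFinP.
    under eq_integral do rewrite abse_EFin ger0_norm ?sqr_ge0//.
    by rewrite (diracE _ msqr) ltry.
  move=> b; rewrite /Rintegral (diracE _ (mcos b)) (diracE _ msqr)/=.
  by rewrite add0r expr0n/= oppr0 mul0r expR0 mulr1.
Qed.

(** * Rotation invariance *)

Section dual_functionals.
Context {R : realType} {E : normedModType R}.

Definition dual : set (E -> R) :=
  [set l | linear (l : E -> R^o) /\ continuous l].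

Lemma dual0 : dual (fun=> 0).
Proof.
by split; [move=> a x y; rewrite scaler0 addr0|move=> x; exact: cvg_cst].
Qed.

Lemma dual_lin a l l' : dual l -> dual l' -> dual (fun x => a * l x + l' x).
Proof.
move=> [ll lc] [ll' lc']; split.
  move=> b x y; rewrite ll ll' /GRing.scale/=; ring.
move=> x; apply: cvgD; last exact: lc'.
by apply: cvgM; [exact: cvg_cst|exact: lc].
Qed.

Lemma dualB l x y : dual l -> l (x - y) = l x - l y.
Proof. by move=> [ll _]; rewrite linear_formB. Qed.

Lemma dualZ l a x : dual l -> l (a *: x) = a * l x.
Proof.
move=> dl; have [ll _] := dl.
have l0 : l 0 = 0 by rewrite -(subrr 0) dualB// subrr.
by have := ll a x 0; rewrite addr0 l0 addr0.
Qed.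

Lemma dualD l x y : dual l -> l (x + y) = l x + l y.
Proof. by move=> [ll _]; have := ll 1 x y; rewrite !scale1r. Qed.

Lemma dual_measurable l : dual l -> measurable_fun setT (l : borel E -> R).
Proof. by move=> [_ lc]; exact: continuous_borel_measurable. Qed.

End dual_functionals.

Section rotation.
Context {R : realType} {E : completeNormedModType R}.
Variables (sepE : separable E) (m : probability (borel E) R).
Hypothesis gm : centered_gaussian m.
Local Notation Om := (borel E * borel E)%type.

Definition rotation45 (z : Om) : Om :=
  ((Num.sqrt 2)^-1 *: ((z.1 : E) - z.2), (Num.sqrt 2)^-1 *: ((z.1 : E) + z.2)).

Definition product_functional : set (Om -> R) :=
  [set f | exists2 l, dual l & exists2 k, dual k & f = fun z => l z.1 + k z.2].

Let c : R := (Num.sqrt 2)^-1.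
Let c2 : c ^+ 2 = 1 / 2.
Proof. by rewrite exprVn sqr_sqrtr// div1r. Qed.

Let q (l : E -> R) := \int[m]_x (l x ^+ 2).

Lemma measurable_rotation45 : measurable_fun setT rotation45.
Proof.
have mfun (l : E -> R) (a : R) : dual l ->
    measurable_fun setT (fun z : Om => c * (l z.1 + a * l z.2)).
  move=> dl; have ml := dual_measurable _ dl.
  apply: measurable_funM => //; apply: measurable_funD.
    exact: measurableT_comp ml measurable_fst.
  by apply: measurable_funM => //; exact: measurableT_comp ml measurable_snd.
apply/measurable_fun_pairP; split; apply: measurable_fun_borel => // l ll lc.
- have dl : dual l by [].
  rewrite (_ : _ \o _ = (fun z : Om => c * (l z.1 + -1 * l z.2))); first exact: mfun.
  by apply/funext => z; rewrite /= (dualZ _ _ _ dl) (dualB _ _ _ dl) mulN1r.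
- have dl : dual l by [].
  rewrite (_ : _ \o _ = (fun z : Om => c * (l z.1 + 1 * l z.2))); first exact: mfun.
  by apply/funext => z; rewrite /= (dualZ _ _ _ dl) (dualD _ _ _ dl) mul1r.
Qed.

(** Fubini: for fixed x the number l x + b is a phase in the integral over y,
    so the one-dimensional formula applies twice. *)
Lemma product_charfun l k b : dual l -> dual k ->
  \int[(m \x m)%E]_z cos (l z.1 + k z.2 + b) = cos b * expR (- (q l + q k) / 2).
Proof.
move=> dl dk; have [ll lc] := dl; have [kl kc] := dk.
have [_ cfl] := gaussian_functional _ _ gm ll lc.
have [_ cfk] := gaussian_functional _ _ gm kl kc.
have ml := dual_measurable _ dl; have mk := dual_measurable _ dk.
have cosC : measurable_fun setT (@cos R).
  by apply: continuous_measurable_fun; exact: continuous_cos.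
have mf : measurable_fun setT (fun z : Om => cos (l z.1 + k z.2 + b)).
  apply: measurableT_comp => //; apply: measurable_funD => //.
  apply: measurable_funD; first exact: measurableT_comp ml measurable_fst.
  exact: measurableT_comp mk measurable_snd.
have cos1 (y : R) : `|cos y| <= 1 by rewrite ler_norml cos_geN1 cos_le1.
have fi : (m \x m)%E.-integrable setT
    (EFin \o (fun z : Om => cos (l z.1 + k z.2 + b))).
  by apply: bounded_integrable => //; exists 1.
rewrite /Rintegral -(integral12_prod_meas1 fi) /fubini_F /=.
have ki x : m.-integrable setT (EFin \o (fun y : borel E => cos (l x + k y + b))).
  apply: bounded_integrable; last by exists 1.
  apply: measurableT_comp => //; apply: measurable_funD => //.
  exact: measurable_funD.
have inner x : (\int[m]_y (cos (l x + k y + b))%:E =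
    (cos (l x + b) * expR (- q k / 2))%:E)%E.
  rewrite (EFin_Rintegral _ _ (ki x)) -cfk; congr EFin.
  by apply: eq_Rintegral => y _; rewrite (addrC (l x)) addrA.
under eq_integral do rewrite inner.
rewrite -/(Rintegral _ _ (fun x : borel E => cos (l x + b) * expR (- q k / 2))).
rewrite RintegralZr//.
  by rewrite cfl -mulrA -expRD; congr (_ * expR _); rewrite -mulrDl opprD.
apply: bounded_integrable; last by exists 1.
by apply: measurableT_comp => //; exact: measurable_funD.
Qed.

(** The two functionals on the left are the coefficients of x and of y in
    l (x - y) / sqrt 2 + k (x + y) / sqrt 2. *)
Lemma variance_parallelogram l k : dual l -> dual k ->
  q (fun x => c * l x + c * k x) + q (fun x => - c * l x + c * k x) = q l + q k.
Proof.
move=> dl dk.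
have isq h : dual h -> m.-integrable setT (EFin \o (fun x => h x ^+ 2)).
  by move=> [hl hc]; have [] := gaussian_functional _ _ gm hl hc.
have dck : dual (fun x => c * k x).
  by under eq_fun do rewrite -[_ * _]addr0; exact: dual_lin dk dual0.
have d1 := dual_lin c _ _ dl dck; have d2 := dual_lin (- c) _ _ dl dck.
rewrite /q -!RintegralD//; [|exact: isq..].
apply: eq_Rintegral => x _.
rewrite [LHS](_ : _ = 2 * c ^+ 2 * (l x ^+ 2 + k x ^+ 2)); last by ring.
by rewrite c2; field.
Qed.

(** The functionals l (x) + k (y) generate the product sigma-algebra, and
    the rotation preserves their characteristic functions. *)
Lemma rotation45_invariant B : measurable B ->
  (m \x m)%E (rotation45 @^-1` B) = (m \x m)%E B.
Proof.
move=> mB.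
pose rot : {mfun Om >-> Om} := HB.pack rotation45
  (isMeasurableFun.Build _ _ _ _ _ measurable_rotation45).
pose P : probability Om R := (m \x m)%E.
rewrite -[LHS]/(distribution P rot B).
have Lmeas f : product_functional f -> measurable_fun setT f.
  move=> [l dl [k dk ->]]; apply: measurable_funD.
    exact: measurableT_comp (dual_measurable _ dl) measurable_fst.
  exact: measurableT_comp (dual_measurable _ dk) measurable_snd.
apply: (charfun_measure_unique _ _ _ (distribution P rot) P product_functional).
- by exists (fun=> 0); [exact: dual0|exists (fun=> 0); [exact: dual0|
    apply/funext => z; rewrite addr0]].
- move=> a _ _ [l dl [k dk ->]] [l' dl' [k' dk' ->]].
  exists (fun x => a * l x + l' x); first exact: dual_lin.
  exists (fun x => a * k x + k' x); first exact: dual_lin.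
  by apply/funext => z; ring.
- exact: Lmeas.
- move=> _ b [l dl [k dk ->]].
  have mcos : measurable_fun setT (fun z : Om => cos (l z.1 + k z.2 + b)).
    apply: measurableT_comp.
      by apply: continuous_measurable_fun; exact: continuous_cos.
    apply: measurable_funD => //; apply: Lmeas.
    by exists l => //; exists k.
  have dck : dual (fun x => c * k x).
    by under eq_fun do rewrite -[_ * _]addr0; exact: dual_lin dk dual0.
  rewrite [RHS]product_charfun// -(variance_parallelogram _ _ dl dk).
  rewrite -product_charfun; [|exact: dual_lin..].
  rewrite /Rintegral; apply: (congr1 fine).
  rewrite integral_distribution//=; last 2 first.
  + exact/measurable_EFinP.
  + apply: bounded_integrable.
      exact: measurableT_comp mcos measurable_rotation45.
    by exists 1 => z; rewrite ler_norml cos_geN1 cos_le1.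
  apply: eq_integral => z _; congr (cos (_ + _))%:E.
  rewrite /= (dualZ _ _ _ dl) (dualZ _ _ _ dk) (dualB _ _ _ dl) (dualD _ _ _ dk).
  by rewrite -/c; ring.
set G := [set B | _].
pose GT := g_sigma_algebraType G.
suff idm : measurable_fun setT (fun z : GT => z : Om).
  by rewrite -[B](preimage_id) -[X in <<s G >> X]setTI; exact: idm.
have mL (f : Om -> R) : product_functional f ->
    measurable_fun setT (f : GT -> R).
  move=> Lf; apply: (measurability _ (RGenOInfty.measurableE R)) => //.
  move=> _ [_ [a ->] <-]; rewrite setTI; apply: sub_sigma_algebra.
  by exists f => //; exists a; apply/seteqP; split => z /=; rewrite in_itv/= andbT.
apply/measurable_fun_pairP; split; apply: measurable_fun_borel => // l ll lc.
- apply: mL; exists l => //; exists (fun=> 0); first exact: dual0.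
  by apply/funext => z; rewrite addr0.
- apply: mL; exists (fun=> 0); first exact: dual0.
  by exists l => //; apply/funext => z; rewrite add0r.
Qed.

End rotation.

(** * Fernique's exponential tail bound *)

Section fernique.
Context {R : realType}.

Let r2 : R := Num.sqrt 2.
Let r2_gt1 : 1 < r2. Proof. by rewrite -sqrtr1 ltr_sqrt// ltr1n. Qed.
Let r2_gt0 : 0 < r2. Proof. exact: lt_trans ltr01 r2_gt1. Qed.
Let r2_sqr : r2 ^+ 2 = 2. Proof. by rewrite sqr_sqrtr. Qed.

(** The radii obtained by iterating u |-> sqrt 2 u + s in
    [gaussian_tail_step]. *)
Fixpoint radius (s : R) n := if n is n'.+1 then r2 * radius s n' + s else s.

Lemma radius_ge s n : 0 < s -> s * n.+1%:R <= radius s n.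
Proof.
move=> s0; elim: n => [|n ih] /=; first by rewrite mulr1.
rewrite -natr1 mulrDr mulr1 lerD2r; apply: (le_trans ih).
have rn0 : 0 < radius s n by apply: lt_le_trans ih; rewrite mulr_gt0.
by rewrite ler_peMl// ltW.
Qed.

Lemma radius_le s : 0 < s ->
  exists2 K, 0 < K & forall n, radius s n.+1 <= K * r2 ^+ n.
Proof.
move=> s0; pose k := s / (r2 - 1).
have r21 : 0 < r2 - 1 by rewrite subr_gt0.
have k0 : 0 < k by rewrite divr_gt0.
exists ((s + k) * r2); first by rewrite mulr_gt0// addr_gt0.
suff E n : radius s n = (s + k) * r2 ^+ n - k.
  by move=> n; rewrite E exprS mulrA lerBlDr lerDl ltW.
elim: n => [|n ih] /=; first by rewrite mulr1 addrK.
by rewrite ih exprS /k; field; rewrite gt_eqF.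
Qed.

(** With r = sqrt 2 ^ n one has 2^n = r^2, and the left-hand side is
    exp(a r - b r^2) with b = - ln rho > 0. The factor 2^n costs at most
    2 exp r, and (a + 1) r - b r^2 <= (a + 1)^2 / (4 b). *)
Lemma gaussian_beats_exponential (a rho : R) : 0 < rho < 1 ->
  exists2 M, 0 < M & forall n,
    expR (a * r2 ^+ n) * rho ^+ (2 ^ n) <= M / (2 ^ (n + 1))%:R.
Proof.
move=> /andP[rho0 rho1]; pose b := - ln rho.
have b0 : 0 < b by rewrite oppr_gt0 ln_lt0// rho0.
exists (4 * expR ((a + 1) ^+ 2 / (4 * b))) => [|n].
  by rewrite mulr_gt0// expR_gt0.
set r := r2 ^+ n; have rr : r ^+ 2 = 2 ^+ n by rewrite exprAC r2_sqr.
have r0 : 0 < r by rewrite exprn_gt0.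
have -> : rho ^+ (2 ^ n) = expR (- b * r ^+ 2).
  by rewrite rr -natrX expRM_natr opprK lnK// posrE.
rewrite natrX exprD expr1 -rr -expRD ler_pdivlMr; last first.
  by rewrite mulr_gt0// exprn_gt0.
have r2e : r ^+ 2 <= 2 * expR r.
  by have := expR_ge1Dxn 1 (ltW r0); rewrite (_ : 2`!%:R = 2)//; lra.
have e0 := expR_ge0 (a * r + - b * r ^+ 2).
apply: (@le_trans _ _ (4 * (expR (a * r + - b * r ^+ 2) * expR r))).
  have := ler_wpM2l e0 r2e; lra.
rewrite ler_wpM2l// -expRD ler_expR.
have sq := sqr_ge0 (2 * b * r - (a + 1)).
rewrite ler_pdivlMr; last by rewrite mulr_gt0.
nra.
Qed.

Context {E : completeNormedModType R}.
Hypothesis sepE : separable E.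

Section one_measure.
Variable m : probability (borel E) R.
Hypothesis gm : centered_gaussian m.

Let G u : R := fine (m [set x : E | u < `|x|]).

Let mG u : m [set x : E | u < `|x|] = (G u)%:E.
Proof. by rewrite /G fineK// fin_num_measure//; exact: measurable_norm_gt. Qed.

Let G_ge0 u : 0 <= G u.
Proof. by rewrite -lee_fin -mG. Qed.

(** Fernique's inequality. The left-hand side is the probability of
    {|x| <= s} x {|y| > sqrt 2 u + s}, hence of its preimage under the
    rotation, where 2 |x| and 2 |y| are at least |x + y| - |x - y| > 2 u. *)
Lemma gaussian_tail_step s u :
  (1 - G s) * G (r2 * u + s) <= G u ^+ 2.
Proof.
pose A : set (borel E) := ~` [set x : E | s < `|x|].
pose B : set (borel E) := [set x : E | r2 * u + s < `|x|].
pose C : set (borel E) := [set x : E | u < `|x|].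
have mA : measurable A by apply: measurableC; exact: measurable_norm_gt.
have mB : measurable B by exact: measurable_norm_gt.
have mC : measurable C by exact: measurable_norm_gt.
rewrite -lee_fin EFinM EFinB expr2 EFinM -!mG.
rewrite -(probability_setC m (measurable_norm_gt s)) -/A -/B -/C.
rewrite -!product_measure1E// -rotation45_invariant//; last exact: measurableX.
apply: le_measure; rewrite ?inE.
- rewrite -[X in measurable X]setTI; apply: measurable_rotation45 => //.
  exact: measurableX.
- exact: measurableX.
move=> [x y] [/= /negP]; rewrite /B /C /rotation45 /= -leNgt !normrZ -/r2.
rewrite gtr0_norm ?invr_gt0// => hd hs.
have {}hd : `|(x : E) - y| <= s * r2 by rewrite mulrC -ler_pdivrMl.
have {}hs : 2 * u + s * r2 < `|(x : E) + y|.
  rewrite ltr_pdivlMl// in hs; apply: le_lt_trans hs.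
  by rewrite mulrDr mulrA -expr2 r2_sqr (mulrC s).
have half (v w : E) : `|v + w| - `|v - w| <= 2 * `|v|.
  have -> : 2 * `|v| = `|(v + w) + (v - w)|.
    by rewrite addrACA subrr addr0 -mulr2n -(scaler_nat 2 v) normrZ ger0_norm.
  rewrite lerBlDr -[X in `|X| <= _](addrK (v - w)); exact: ler_normB.
have hx := half x y; have := half y x.
rewrite (addrC (y : E)) (distrC (y : E)) => hy.
by split; rewrite -(ltr_pM2l (ltr0n R 2));
  [apply: lt_le_trans hx|apply: lt_le_trans hy]; lra.
Qed.

(** Induction on G (radius s n) <= (1 - beta) rho^(2^n), which squares
    correctly because 1 - G s >= 1 - beta. *)
Lemma gaussian_tail_iter s beta n : G s <= beta -> 0 < beta < 1 / 2 ->
  G (radius s n) <= (beta / (1 - beta)) ^+ (2 ^ n).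
Proof.
move=> Gs /andP[b0 b1]; have b10 : 0 < 1 - beta by lra.
set rho := beta / (1 - beta).
suff h : G (radius s n) <= (1 - beta) * rho ^+ (2 ^ n).
  apply: (le_trans h); rewrite ler_piMl; [by []| |lra].
  by rewrite exprn_ge0// divr_ge0// ltW.
elim: n => [|n ih] /=; first by rewrite expn0 expr1 mulrC divfK// gt_eqF.
rewrite -(ler_pM2l b10).
apply: (@le_trans _ _ ((1 - G s) * G (r2 * radius s n + s))).
  by rewrite ler_wpM2r//; lra.
apply: le_trans (gaussian_tail_step _ _) _.
have h := lerXn2r 2 (G_ge0 _) (mulr_ge0 (ltW b10) (exprn_ge0 (2 ^ n)
  (divr_ge0 (ltW b0) (ltW b10)))) ih.
by apply: (le_trans h); rewrite exprMn -exprM -expnSr mulrA -expr2.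
Qed.

(** On the shell radius s n < |x| <= radius s n.+1 the integrand is at most
    exp(t radius s n.+1), so it is dominated everywhere by exp(t s) plus the
    series of these values times the tail indicators. *)
Lemma gaussian_exp_moment_le (s beta t M : R) :
  0 < s -> 0 < beta < 1 / 2 -> 0 < t ->
  (m [set x : E | (s < `|x|)%R] <= beta%:E)%E ->
  (forall n, expR (t * radius s n.+1) * (beta / (1 - beta)) ^+ (2 ^ n) <=
    M / (2 ^ (n + 1))%:R) ->
  (\int[m]_x (expR (t * `|x : E|)%R)%:E <= (expR (t * s) + M)%:E)%E.
Proof.
move=> s0 b01 t0 ms hM.
have Gs : G s <= beta by rewrite -lee_fin -mG.
pose f n (x : borel E) : \bar R :=
  (expR (t * radius s n.+1) * \1_[set x : E | (radius s n < `|x|)%R] x)%:E.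
have f0 n x : (0 <= f n x)%E by rewrite lee_fin mulr_ge0 ?expR_ge0.
have mi n : measurable_fun setT
    (\1_([set x : E | (radius s n < `|x|)%R] : set (borel E)) : borel E -> R).
  by apply: measurable_indic; exact: measurable_norm_gt.
have mf n : measurable_fun setT (f n).
  by apply/measurable_EFinP/measurable_funM.
have mexp : measurable_fun setT (fun x : borel E => expR (t * `|x : E|)).
  apply: measurableT_comp => //; apply: measurable_funM => //.
  by apply: continuous_borel_measurable; exact: norm_continuous.
have int_f n : (\int[m]_x f n x <= (M / (2 ^ (n + 1))%:R)%:E)%E.
  rewrite /f; under eq_integral do rewrite EFinM.
  rewrite ge0_integralZl//; last exact/measurable_EFinP.
  rewrite integral_indic//; last exact: measurable_norm_gt.
  rewrite setIT [X in (_ * X)%E]mG -EFinM lee_fin; apply: le_trans (hM n).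
  by rewrite ler_wpM2l ?expR_ge0// gaussian_tail_iter.
apply: (@le_trans _ _ (\int[m]_x ((expR (t * s))%:E + \sum_(n <oo) f n x))%E).
  apply: ge0_le_integral => //.
  - exact/measurable_EFinP.
  - apply: emeasurable_funD => //.
    by apply: ge0_emeasurable_sum.
  move=> x _.
  have [n nP] : exists n, `|x : E| <= radius s n.
    exists (Num.truncn (`|x : E| / s)); apply: le_trans (radius_ge _ _ s0).
    by rewrite mulrC -ler_pdivrMr// ltW// truncnS_gt.
  elim: n nP => [|n ih] nP.
    apply: (@le_trans _ _ (expR (t * s))%:E).
      by rewrite lee_fin ler_expR ler_wpM2l// ltW.
    by rewrite leeDl// nneseries_ge0.
  have [/ih//|xn] := leP `|x : E| (radius s n).
  apply: (@le_trans _ _ (f n x)).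
    by rewrite /f indicE mem_set//= mulr1 lee_fin ler_expR ler_wpM2l// ltW.
  apply: (@le_trans _ _ (\sum_(i <oo) f i x)%E); last first.
    by rewrite leeDr// lee_fin expR_ge0.
  apply: le_trans (nneseries_lim_ge n.+1 _) => //.
  rewrite big_nat_recr//= leeDr// sume_ge0//.
rewrite ge0_integralD//; last 2 first.
- by move=> x _; exact: nneseries_ge0.
- by apply: ge0_emeasurable_sum.
rewrite integral_cst// [X in (_ * X)%E]probability_setT mule1 EFinD leeD2l//.
rewrite integral_nneseries//.
have geo := @cvg_geometric_eseries_half R M 0.
rewrite expr0 divr1 in geo; rewrite -(cvg_lim _ geo)//.
by apply: lee_nneseries => [n _ _|n _]; [exact: integral_ge0|exact: int_f].
Qed.

End one_measure.

(** The bound is chosen before the measure: it depends on s, beta and t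
    only. *)
Theorem gaussian_exp_moment_bounded (s beta t : R) :
  0 < s -> 0 < beta < 1 / 2 -> 0 < t ->
  exists B : R, forall m : probability (borel E) R, centered_gaussian m ->
    (m [set x : E | (s < `|x|)%R] <= beta%:E)%E ->
    (\int[m]_x (expR (t * `|x : E|)%R)%:E <= B%:E)%E.
Proof.
move=> s0 b01 t0; have [K K0 radK] := radius_le s s0.
have rho01 : 0 < beta / (1 - beta) < 1.
  case/andP: b01 => b0 b1; have b10 : 0 < 1 - beta by lra.
  by rewrite divr_gt0//= ltr_pdivrMr//; lra.
have [M M0 hM] := gaussian_beats_exponential (t * K) _ rho01.
exists (expR (t * s) + M) => m gm ms.
apply: (gaussian_exp_moment_le m gm s beta) => // n; apply: le_trans (hM n).
have /andP[/ltW rho0 _] := rho01.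
by rewrite ler_wpM2r ?exprn_ge0// ler_expR -mulrA ler_wpM2l// ltW.
Qed.

End fernique.

Theorem corollary2p1 (R : realType) (E : completeNormedModType R)
    (sepE : separable E) (A : Type) (mu : A -> probability (borel E) R)
    (gauss_mu : forall a, centered_gaussian (mu a)) :
  ((exists s beta : R, [/\ 0 < s, beta < 1 / 2 &
      forall a, (mu a [set x : E | (s < `|x|)%R] <= beta%:E)%E]) ->
   forall t : R, 0 < t ->
     (ereal_sup [set \int[mu a]_x (expR (t * `|x : E|)%R)%:E | a in [set: A]]
        < +oo)%E) /\
  (tight mu ->
   forall t : R, 0 < t ->
     (ereal_sup [set \int[mu a]_x (expR (t * `|x : E|)%R)%:E | a in [set: A]]
        < +oo)%E).
Proof.
have main : (exists s beta : R, [/\ 0 < s, beta < 1 / 2 &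
      forall a, (mu a [set x : E | (s < `|x|)%R] <= beta%:E)%E]) ->
    forall t : R, 0 < t ->
    (ereal_sup [set \int[mu a]_x (expR (t * `|x : E|)%R)%:E | a in [set: A]]
        < +oo)%E.
  move=> [s [beta [s0 b12 mus]]] t t0.
  (* the uniform bound needs a positive beta; here beta <= 0 is possible *)
  have b01 : 0 < Num.max beta (1 / 4) < 1 / 2.
    by rewrite lt_max gt_max b12; apply/andP; split; [apply/orP; right|]; lra.
  have [B hB] := gaussian_exp_moment_bounded sepE s _ t s0 b01 t0.
  apply: (@le_lt_trans _ _ B%:E); last exact: ltry.
  apply: ge_ereal_sup => _ [a _ <-]; apply: hB => //.
  by apply: le_trans (mus a) _; rewrite lee_fin le_max lexx.
split=> // tight_mu; apply: main.
have [|K cK muK] := tight_mu (1 / 4); first by lra.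
have [M [_ KM]] := compact_bounded cK.
pose s := Num.max 1 (M + 1).
have Ms : M < s by rewrite lt_max ltrDl ltr01 orbT.
exists s, (1 / 4); split; [by rewrite lt_max ltr01|lra|] => a.
apply: (le_trans _ (ltW (muK a))); apply: le_measure; rewrite ?inE.
- exact: measurable_norm_gt.
- apply: sub_sigma_algebra; apply: closed_openC.
  exact: compact_closed (@norm_hausdorff _ E) cK.
- by move=> x /= sx Kx; have := KM s Ms x Kx; rewrite /= leNgt sx.
Qed.
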